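(* Let $(L,E)$ be a tree with amplitude matrices $(\psi_{xy}(i,j))$ given for every edge, and let $\varphi$ be the state on $\mathcal B_L$ determined by $$\varphi(a)=\frac1d\lim_{\Lambda\uparrow L}\langle\psi_\Lambda,a\,\psi_\Lambda\rangle,\qquad a\in\mathcal B_{L,\mathrm{loc}},$$ where the limit is over finite connected subsets $\Lambda\subseteq L$ increasing to $L$. Fix $x_1\in L$ and define $\Lambda_1=\{x_1\}$, $\Lambda_n=\overline{\Lambda}_{n-1}$ for $n\ge2$. Then $\varphi$ is a $d$-Markov chain associated to $\{\Lambda_n\}$.
   Context: Graphs: $(L,E)$ is a non-oriented simple graph with $L$ non-empty and at most countable; $x\sim y$ means $\{x,y\}\in E$. All graphs are connected and locally finite. A tree is a connected graph without loops (cycles). For finite $\Lambda\subseteq L$: $\vec\partial\Lambda=\{x\in L\setminus\Lambda:\ x\sim y\text{ for some }y\in\Lambda\}$ and $\overline\Lambda=\Lambda\cup\vec\partial\Lambda$. Algebras: fix $d\in\mathbb N$. To each $x\in L$ is associated a Hilbert space $\mathcal H_x$ of dimension $d$ with a fixed orthonormal basis $e_1(x),\dots,e_d(x)$. For finite $\Lambda\subseteq L$, $\mathcal H_\Lambda=\bigotimes_{x\in\Lambda}\mathcal H_x$, $\mathcal B_\Lambda=\mathcal B(\mathcal H_\Lambda)$ ($\mathcal B_\emptyset=\mathbb C$); for $\Lambda\subseteq\Lambda'$, $\mathcal B_\Lambda$ is identified with $\mathcal B_\Lambda\otimes I\subseteq\mathcal B_{\Lambda'}$. $\mathcal B_{L,\mathrm{loc}}=\bigcup_{\Lambda\text{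 finite}}\mathcal B_\Lambda$ and $\mathcal B_L$ is its $C^*$-inductive limit. For $\omega_\Lambda:\Lambda\to\{1,\dots,d\}$ put $e_{\omega_\Lambda}=\bigotimes_{x\in\Lambda}e_{\omega_\Lambda(x)}(x)$. Amplitude matrices: for each edge $\{x,y\}$, a complex $d\times d$ matrix $(\psi_{xy}(i,j))$ with $\sum_{i}|\psi_{xy}(i,j)|^2=1$ for all $j$ and $\sum_{j}|\psi_{xy}(i,j)|^2=1$ for all $i$; first index refers to $x$, second to $y$, with $\psi_{yx}(j,i)=\psi_{xy}(i,j)$. For finite $\Lambda$, with $E_\Lambda=\{\{x,y\}:x,y\in\Lambda,\ x\sim y\}$, $$\psi_\Lambda=\sum_{\omega_\Lambda}\Big(\prod_{\{x,y\}\in E_\Lambda}\psi_{xy}(\omega_\Lambda(x),\omega_\Lambda(y))\Big)e_{\omega_\Lambda}\in\mathcal H_\Lambda .$$ For a tree the limit defining $\varphi$ exists for every local $a$ and $\varphi$ is a state on $\mathcal B_L$. Quasi-conditional expectation: for unital $C^*$-algebras $\mathcal C\subset\mathcal B\subset\mathcal A$, a quasi-conditional expectation with respect to the triple is a completely positive identity-preserving linear map $\mathcal E:\mathcal A\to\mathcal B$ with $\mathcal E(ca)=c\,\mathcal E(a)$ for all $a\in\mathcal A$, $c\in\mathcal C$. $d$-Markov chain: let $\{\Lambda_n\}_{n\ge1}$ be an increasing sequence of finite sets with $\overline\Lambda_n=\Lambda_{n+1}$ (so $\Lambda_n\uparrow L$), and $\Lambda_0=\emptyset$. A state $\varphi$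 on $\mathcal B_L$ is a $d$-Markov chain associated to $\{\Lambda_n\}$ if there exist, for each $n\in\mathbb N$, a quasi-conditional expectation $\mathcal E_n$ with respect to the triple $\mathcal B_{\Lambda_{n-1}}\subset\mathcal B_{\Lambda_n}\subset\mathcal B_{\Lambda_{n+1}}$, and an initial state $\rho$ on $\mathcal B_{\Lambda_1}$, such that $\varphi=\lim_{n\to\infty}\rho\circ\mathcal E_1\circ\mathcal E_2\circ\cdots\circ\mathcal E_n$ in the weak-$*$ topology; that is, $\varphi(a)=\lim_{n\to\infty}\rho\circ\mathcal E_1\circ\cdots\circ\mathcal E_n(a)$ for every $a\in\mathcal B_{L,\mathrm{loc}}$ (defined for $n$ large enough that $a\in\mathcal B_{\Lambda_{n+1}}$). *)

(* Defs.v *)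
From HB Require Import structures.
From mathcomp Require Import all_boot all_order all_algebra finmap.
From mathcomp Require Import all_classical all_reals all_analysis.
From mathcomp Require Import complex.
Set Implicit Arguments.
Unset Strict Implicit.
Unset Printing Implicit Defensive.
Import Order.TTheory GRing.Theory Num.Theory numFieldNormedType.Exports.

Local Open Scope classical_set_scope.
Local Open Scope ring_scope.
Local Open Scope sesquilinear_scope.

(** * Unital *-algebras and C*-algebras *)

HB.mixin Record Algebra_isStarAlgebra (K : numClosedFieldType) A
    of GRing.Algebra K A := {
  star : A -> A;
  starK : involutive star;
  starD : {morph star : a b / a + b};
  starZ : forall (k : K) (a : A), star (k *: a) = k^* *: star a;
  starM : forall a b : A, star (a * b) = star b * star a
}.

#[short(type="starAlgType")]
HB.structure Definition StarAlgebra (K : numClosedFieldType) :=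
  {A of GRing.Algebra K A & Algebra_isStarAlgebra K A}.

(* The norm is a field of its own: the only MathComp structures that join a ring
   with [normedZmodType] are the number domains, whose norm is multiplicative. *)
HB.mixin Record StarAlgebra_isCStarAlgebra (K : numClosedFieldType) A
    of StarAlgebra K A := {
  cnorm : A -> K;
  cnorm_eq0 : forall a : A, cnorm a = 0 -> a = 0;
  cnormD : forall a b : A, cnorm (a + b) <= cnorm a + cnorm b;
  cnormZ : forall (k : K) (a : A), cnorm (k *: a) = `|k| * cnorm a;
  cnormM : forall a b : A, cnorm (a * b) <= cnorm a * cnorm b;
  cnorm_star : forall a : A, cnorm (star a * a) = cnorm a ^+ 2;
  cnorm_complete : forall u : nat -> A,
    (forall e, 0 < e -> exists N, forall m n, (N <= m)%N -> (N <= n)%N ->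
       cnorm (u m - u n) < e) ->
    exists l, forall e, 0 < e -> exists N, forall n, (N <= n)%N ->
       cnorm (u n - l) < e
}.

#[short(type="cstarAlgType")]
HB.structure Definition CStarAlgebra (K : numClosedFieldType) :=
  {A of StarAlgebra K A & StarAlgebra_isCStarAlgebra K A}.

Section StarAlgebraNotions.
Variable K : numClosedFieldType.

Definition is_state (A : starAlgType K) (f : A -> K) : Prop :=
  [/\ scalar f, f 1 = 1 & forall a, 0 <= f (star a * a)].

Definition star_mx (A : starAlgType K) k (X : 'M[A]_k) : 'M[A]_k :=
  (map_mx star X)^T.

Definition positive_mx (A : starAlgType K) k (X : 'M[A]_k) : Prop :=
  exists Y : 'M[A]_k, X = star_mx Y *m Y.

Definition completely_positive (A B : starAlgType K) (f : A -> B) : Prop :=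
  forall k (X : 'M[A]_k), positive_mx X -> positive_mx (map_mx f X).

(* The inclusions of the triple D < B < A are the maps i and j. *)
Definition quasi_conditional_expectation (D B A : starAlgType K)
    (i : D -> B) (j : B -> A) (E : A -> B) : Prop :=
  [/\ linear E, E 1 = 1, completely_positive E &
      forall (c : D) (a : A), E (j (i c) * a) = i c * E a].

End StarAlgebraNotions.

(** * Trees *)

Section Graphs.
Variables (L : countType) (adj : rel L).

Definition simple_graph : Prop := symmetric adj /\ irreflexive adj.

Definition locally_finite : Prop := forall x, finite_set [set y | adj x y].

Definition connected_graph : Prop :=
  forall x y, exists2 p, path adj x p & last x p = y.

(* [x; y] is a [ucycle] for every edge, hence the bound 2. *)
Definition acyclic : Prop := forall c, ucycle adj c -> (size c <= 2)%N.

Definition is_tree : Prop :=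
  [/\ simple_graph, locally_finite, connected_graph & acyclic].

Definition connected_fset (V : {fset L}) : Prop :=
  forall x y, x \in V -> y \in V ->
    exists p, [/\ path adj x p, all (mem V) p & last x p = y].

(* Limits over finite connected subsets increasing to L are limits along this
   filter. *)
Definition connected_increasing : set_system {fset L} :=
  filter_from connected_fset
    (fun V0 => [set V | connected_fset V /\ (V0 `<=` V)%fset]).

(* [fset_set] has the value fset0 on infinite sets; the boundary of a finite set
   is finite when the graph is locally finite. *)
Definition out_boundary (V : {fset L}) : {fset L} :=
  fset_set [set x | x \notin V /\ exists2 y, y \in V & adj x y].

Definition bar (V : {fset L}) : {fset L} := (V `|` out_boundary V)%fset.

Definition ball_seq (x1 : L) (n : nat) : {fset L} :=
  if n is m.+1 then iter m bar [fset x1]%fset else fset0.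

Definition exhausting (V : nat -> {fset L}) : Prop :=
  [/\ V 0%N = fset0,
      forall n, V n.+2 = bar (V n.+1),
      forall n, (V n `<=` V n.+1)%fset &
      forall x, exists n, x \in V n].

End Graphs.

(** * Local algebras *)

Section LocalAlgebras.
Variables (K : numClosedFieldType) (L : countType) (d : nat).

(* The configurations V -> {1..d}; they index the basis e_w of H_V. *)
Definition conf (V : {fset L}) := {ffun V -> 'I_d}.

Hypothesis d_gt0 : (0 < d)%N.

(* [d_gt0] makes this a nontrivial ring, as [algType] requires. *)
Definition op (V : {fset L}) := let _ := d_gt0 in 'M[K]_#|conf V|.
HB.instance Definition _ V := GRing.PzRing.copy (op V) 'M[K]_#|conf V|.
HB.instance Definition _ V := GRing.Lmodule.copy (op V) 'M[K]_#|conf V|.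

Section OpStar.
Variable V : {fset L}.
Implicit Types a b : op V.

Fact op_oner_neq0 : 1 != 0 :> op V.
Proof.
apply/eqP => /matrixP /(_ (enum_rank [ffun=> Ordinal d_gt0])
                          (enum_rank [ffun=> Ordinal d_gt0])).
by rewrite !mxE eqxx => /eqP; rewrite oner_eq0.
Qed.

HB.instance Definition _ := GRing.PzSemiRing_isNonZero.Build (op V) op_oner_neq0.

Fact op_scaleAl (k : K) a b : k *: (a * b) = (k *: a) * b.
Proof. exact: scalemxAl. Qed.

HB.instance Definition _ :=
  GRing.Lmodule_isLalgebra.Build K (op V) op_scaleAl.

Fact op_scaleAr (k : K) a b : k *: (a * b) = a * (k *: b).
Proof. exact: scalemxAr. Qed.

HB.instance Definition _ :=
  GRing.Lalgebra_isAlgebra.Build K (op V) op_scaleAr.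

Definition op_star a : op V := a^t*.

Fact op_starK : involutive op_star.
Proof. by move=> a; apply/matrixP => i j; rewrite !mxE conjCK. Qed.

Fact op_starD : {morph op_star : a b / a + b}.
Proof. by move=> a b; apply/matrixP => i j; rewrite !mxE rmorphD. Qed.

Fact op_starZ (k : K) a : op_star (k *: a) = k^* *: op_star a.
Proof. by apply/matrixP => i j; rewrite !mxE rmorphM. Qed.

Fact op_starM a b : op_star (a * b) = op_star b * op_star a.
Proof.
by rewrite /op_star [a * b]/(a *m b) trmx_mul map_mxM.
Qed.

HB.instance Definition _ := Algebra_isStarAlgebra.Build K (op V)
  op_starK op_starD op_starZ op_starM.

End OpStar.

Definition conf_restrict (V W : {fset L}) (sVW : (V `<=` W)%fset) (w : conf W) :
  conf V := [ffun x => w (fincl sVW x)].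

Definition agree_off (V W : {fset L}) (w w' : conf W) : bool :=
  [forall x : W, (val x \notin V) ==> (w x == w' x)].

(* The operator a (x) I on H_W = H_V (x) H_(W \ V). *)
Definition tensor_id (V W : {fset L}) (sVW : (V `<=` W)%fset) (a : op V) :
  op W :=
  \matrix_(i, j)
    (a (enum_rank (conf_restrict sVW (enum_val i)))
       (enum_rank (conf_restrict sVW (enum_val j)))
     *+ agree_off V (enum_val i) (enum_val j)).

(* The inclusion B_V < B_W, with junk value 0 when V is not included in W. *)
Definition embed (V W : {fset L}) (a : op V) : op W :=
  if @idP (V `<=` W)%fset is ReflectT sVW then tensor_id sVW a else 0.

(* The C*-inductive limit B_L of the local algebras (unique up to isomorphism),
   as a C*-algebra A with compatible inclusions iota_V : B_V -> A of dense
   union.  Being injective *-homomorphisms, these are isometric. *)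
Definition inductive_limit (A : cstarAlgType K)
    (iota : forall V : {fset L}, op V -> A) : Prop :=
  [/\ forall V, [/\ linear (@iota V), monoid_morphism (@iota V),
                    {morph @iota V : a / star a} & injective (@iota V)],
      forall V W (a : op V), (V `<=` W)%fset -> iota W (embed W a) = iota V a
    & forall (b : A) e, 0 < e -> exists V (a : op V), cnorm (b - iota V a) < e].

(** * Amplitudes *)

Variable adj : rel L.

Definition amplitudes (psi : L -> L -> 'M[K]_d) : Prop :=
  forall x y, adj x y ->
    [/\ forall j, \sum_i `|psi x y i j| ^+ 2 = 1,
        forall i, \sum_j `|psi x y i j| ^+ 2 = 1
      & forall i j, psi y x j i = psi x y i j].

(* The condition on ranks selects one orientation of each edge; as
   psi y x j i = psi x y i j, the choice does not matter. *)
Definition psi_vec (psi : L -> L -> 'M[K]_d) (V : {fset L}) :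
  'cV[K]_#|conf V| :=
  \col_i let w : conf V := enum_val i in
    \prod_(e : V * V | adj (val e.1) (val e.2) &&
                        (enum_rank e.1 < enum_rank e.2)%N)
      psi (val e.1) (val e.2) (w e.1) (w e.2).

Definition inner n (u v : 'cV[K]_n) : K := (u^t* *m v) 0 0.

Definition expect (psi : L -> L -> 'M[K]_d) (V : {fset L}) (a : op V) : K :=
  inner (psi_vec psi V) (a *m psi_vec psi V).

(** * Markov chains *)

(* With E_1, E_2, ... the expectations, E n is E_(n+1), defined on B_(V_(n+2)), and
   markov_comp rho E n is rho o E_1 o ... o E_n, defined on B_(V_(n+1)). *)
Fixpoint markov_comp (V : nat -> {fset L}) (rho : op (V 1%N) -> K)
    (E : forall n, op (V n.+2) -> op (V n.+1)) (n : nat) :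
    op (V n.+1) -> K :=
  if n is m.+1 return op (V n.+1) -> K
  then fun a => markov_comp rho E (E m a) else rho.

Definition d_markov_chain (A : cstarAlgType K)
    (iota : forall V : {fset L}, op V -> A) (V : nat -> {fset L})
    (phi : A -> K) : Prop :=
  [/\ exhausting adj V, is_state phi &
    exists (rho : op (V 1%N) -> K)
           (E : forall n, op (V n.+2) -> op (V n.+1)),
    [/\ is_state rho,
        forall n, quasi_conditional_expectation
          (@embed (V n) (V n.+1)) (@embed (V n.+1) (V n.+2)) (E n)
      & forall (W : {fset L}) (a : op W),
          (fun n => markov_comp rho E (embed (V n.+1) a)) @ \oo
            --> phi (iota W a)]].

End LocalAlgebras.

(* Main.v *)
Require Import Defs.
From HB Require Import structures.
From mathcomp Require Import all_boot all_order all_algebra finmap.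
From mathcomp Require Import all_classical all_reals all_analysis.
From mathcomp Require Import complex.
Set Implicit Arguments.
Unset Strict Implicit.
Unset Printing Implicit Defensive.
Import Order.TTheory GRing.Theory Num.Theory numFieldNormedType.Exports.

Local Open Scope classical_set_scope.
Local Open Scope ring_scope.
Local Open Scope sesquilinear_scope.

(** Write [B n] for the balls around [x1] and let [T] be the map from
   H_(B n.+1) to H_(B n.+2) that sends [e_v] to the tensor product of [e_v] with
   the vectors  sum_i psi_(p(x) x) (v (p(x))) i e_i(x),  one for each site [x] of
   the new layer, where p(x), the parent of [x], is its neighbour in B n.+1.
   Three facts make the theorem true.

   - psi_(B n.+2) = T psi_(B n.+1).  The edges of the larger ball are those of the
     smaller one and the edges from a new site to its parent: two new sites are
     never adjacent, since such an edge would close a cycle through the smaller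
     ball ([psi_vec_extension]).
   - [T] is an isometry.  A new site has exactly one neighbour in the smaller
     ball, again because two of them would close a cycle, so the squared norm of
     [T e_v] is a product of row sums  sum_i |psi_(p(x) x) (v (p(x))) i|^2 = 1
     ([extension_mx_isometry]).
   - [T] intertwines the two copies of an operator on B n, because the parents of
     new sites lie outside B n, all of whose neighbours are in B n.+1 already: the
     vectors attached to the new sites do not see what happens inside B n
     ([extension_mx_commute]).

   Hence  E a = T^* a T  is unital, completely positive, and satisfies
   E (c a) = c E a  for c on B n.  With the initial state
   rho a = <psi_(B 1), a psi_(B 1)> / d, the composite rho o E_1 o ... o E_n is
   exactly  a |-> <psi_(B n.+1), a psi_(B n.+1)> / d,  and it converges to phi
   because the balls are connected and eventually contain every finite set.

   Complete positivity has to produce a factor in matrices over the smaller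
   algebra, while [T] leaves a factor with too many rows; a Gram matrix always has
   a square factor, given by its spectral decomposition ([gram_square]). *)

(** * Gram matrices and complete positivity *)

Section Positivity.
Variable K : numClosedFieldType.

Lemma mxadjM m n p (A : 'M[K]_(m, n)) (B : 'M[K]_(n, p)) :
  (A *m B)^t* = B^t* *m A^t*.
Proof. by rewrite trmx_mul map_mxM. Qed.

Lemma mxadjK m n (A : 'M[K]_(m, n)) : A^t*^t* = A.
Proof. by apply/matrixP => i j; rewrite !mxE conjCK. Qed.

Lemma mxadj_block p q (p_ : 'I_p -> nat) (q_ : 'I_q -> nat)
    (B : forall i j, 'M[K]_(p_ i, q_ j)) :
  (\mxblock_(i, j) B i j)^t* = \mxblock_(j, i) (B i j)^t*.
Proof. by apply/matrixP => i j; rewrite !mxE. Qed.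

Lemma gram_diag_ge0 m n (B : 'M[K]_(m, n)) i : 0 <= (B^t* *m B) i i.
Proof.
rewrite mxE sumr_ge0 // => l _.
by rewrite !mxE mulrC mul_conjC_ge0.
Qed.

(** The spectral theorem writes a Gram matrix as P^* diag(s) P with [s >= 0];
   [diag(sqrt s) P] is then a square factor. *)
Lemma gram_square m n (B : 'M[K]_(m, n)) :
  exists Z : 'M[K]_n, B^t* *m B = Z^t* *m Z.
Proof.
set A := B^t* *m B.
have A_adj : A^t* = A by rewrite /A mxadjM mxadjK.
have /orthomx_spectralP : A \is normalmx by apply/normalmxP; rewrite A_adj.
set P := spectralmx A; set s := spectral_diag A => defA.
have uP : P \is unitarymx by exact: spectral_unitarymx.
rewrite (invmx_unitary uP) in defA.
have PPV : P *m P^t* = 1%:M by apply/unitarymxP.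
have s_ge0 i : 0 <= s 0 i.
  (* The spectrum is the diagonal of the Gram matrix of [B P^*]. *)
  have -> : s 0 i = ((B *m P^t*)^t* *m (B *m P^t*)) i i.
    rewrite mxadjM mxadjK mulmxA -(mulmxA P) -/A defA !mulmxA PPV mul1mx.
    by rewrite -mulmxA PPV mulmx1 mxE eqxx mulr1n.
  exact: gram_diag_ge0.
exists (diag_mx (map_mx sqrtC s) *m P).
rewrite {1}defA mxadjM -!mulmxA; congr (_ *m _); rewrite !mulmxA; congr (_ *m _).
apply/matrixP => i j; rewrite mul_mx_diag !mxE.
have [->|_] := eqVneq i j; last by rewrite mulr0n rmorph0 mul0r.
rewrite !mulr1n geC0_conj ?sqrtC_ge0 //.
by rewrite -expr2 sqrtCK.
Qed.

End Positivity.

Section CompletePositivity.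
Variables (K : numClosedFieldType) (L : countType) (d : nat) (d_gt0 : (0 < d)%N).
Notation op := (op K d_gt0).

Lemma op_mulE (V : {fset L}) (a b : op V) : a * b = a *m b.
Proof. by []. Qed.

Lemma op_starE (V : {fset L}) (a : op V) : star a = a^t*.
Proof. by []. Qed.

(** [positive_mx] asks for a square factor with entries in the algebra itself.
   Rectangular blocks [W l i] are enough: assemble them into one large matrix,
   take a square factor of its Gram matrix, and cut it into blocks again. *)
Lemma positive_mx_gram (V : {fset L}) k m N (X : 'M[op V]_k)
    (W : 'I_m -> 'I_k -> 'M[K]_(N, #|conf d V|)) :
  (forall i j, X i j = \sum_l (W l i)^t* *m W l j :> 'M[K]_#|conf d V|) ->
  positive_mx X.
Proof.
move=> defX.
pose B := \mxblock_(l < m, i < k) (W l i : 'M[K]_(N, #|conf d V|)).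
have [Z defZ] := gram_square B.
exists (\matrix_(l, j) (submxblock Z l j : op V)).
apply/matrixP => i j; rewrite defX.
transitivity (submxblock (B^t* *m B) i j).
  rewrite /B mxadj_block mul_mxblock mxblockK; apply: eq_bigr => l _.
  by [].
rewrite defZ -[in LHS](submxblockK Z) mxadj_block mul_mxblock mxblockK.
by rewrite mxE; apply: eq_bigr => l _; rewrite !mxE.
Qed.

Lemma compression_completely_positive (V W : {fset L})
    (T : 'M[K]_(#|conf d W|, #|conf d V|)) :
  completely_positive (fun a : op W => (T^t* *m a *m T : op V)).
Proof.
move=> k X [Y ->].
apply: (@positive_mx_gram _ _ _ _ _
         (fun l i => (Y l i : 'M[K]_#|conf d W|) *m T)).
move=> i j; rewrite !mxE mulmx_sumr mulmx_suml; apply: eq_bigr => l _.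
rewrite !mxE op_starE op_mulE mxadjM.
by rewrite !mulmxA.
Qed.

End CompletePositivity.

(** * Operators on overlapping regions *)

Section Configurations.
Variables (L : countType) (d : nat) (d_gt0 : (0 < d)%N).
Implicit Types U V W : {fset L}.

(** Functions defined on all sites make restriction from one region to another
   a matter of forgetting values, and turn products over the sites of a region
   into products over a sequence in [L]. *)
Definition conf_of (V : {fset L}) (t : L -> 'I_d) : conf d V :=
  [ffun x => t (val x)].

Definition conf_total (V : {fset L}) (v : conf d V) (x : L) : 'I_d :=
  if insub x is Some y then v y else Ordinal d_gt0.

Lemma conf_totalE V (v : conf d V) (y : V) : conf_total v (val y) = v y.
Proof. by rewrite /conf_total valK. Qed.

Lemma conf_totalK V (v : conf d V) : conf_of V (conf_total v) = v.
Proof. by apply/ffunP => y; rewrite ffunE conf_totalE. Qed.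

Lemma conf_restrict_of V W (sVW : (V `<=` W)%fset) t :
  conf_restrict sVW (conf_of W t) = conf_of V t.
Proof. by apply/ffunP => y; rewrite !ffunE. Qed.

Lemma conf_restrict_trans U V W (sUV : (U `<=` V)%fset) (sVW : (V `<=` W)%fset)
    (sUW : (U `<=` W)%fset) (w : conf d W) :
  conf_restrict sUV (conf_restrict sVW w) = conf_restrict sUW w.
Proof.
by apply/ffunP => y; rewrite !ffunE; congr (w _); apply/val_inj.
Qed.

Lemma agree_offP V W (w w' : conf d W) :
  reflect (forall x : W, val x \notin V -> w x = w' x) (agree_off V w w').
Proof.
apply: (iffP forallP) => [h x xV|h x]; first by apply/eqP/(implyP (h x)).
by apply/implyP => xV; apply/eqP/h.
Qed.

Lemma agree_off_sym V W (w w' : conf d W) : agree_off V w w' = agree_off V w' w.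
Proof. by apply: eq_forallb => x; rewrite eq_sym. Qed.

Lemma agree_off_trans U V W (sUV : (U `<=` V)%fset) (sVW : (V `<=` W)%fset)
    (w w' : conf d W) :
  agree_off U w w' =
  agree_off V w w' &&
    agree_off U (conf_restrict sVW w) (conf_restrict sVW w').
Proof.
apply/agree_offP/andP => [h|[/agree_offP hV /agree_offP hU] x xU].
  split; apply/agree_offP => x xV.
    by apply: h; apply: contra xV; apply: (fsubsetP sUV).
  by rewrite !ffunE; apply: h.
have [xV|] := boolP (val x \in V); last exact: hV.
have := hU [` xV]%fset xU.
rewrite !ffunE.
by have -> : fincl sVW [` xV]%fset = x by apply: val_inj.
Qed.

End Configurations.

Section Embeddings.
Variables (K : numClosedFieldType) (L : countType) (d : nat) (d_gt0 : (0 < d)%N).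
Implicit Types U V W : {fset L}.
Notation op := (op K d_gt0).

Lemma embedE V W (sVW : (V `<=` W)%fset) (a : op V) :
  embed W a = tensor_id sVW a.
Proof.
rewrite /embed; case: {-}_ / idP => // sVW'.
by rewrite (bool_irrelevance sVW sVW').
Qed.

Lemma embed_star V W (sVW : (V `<=` W)%fset) (a : op V) :
  embed W (star a) = star (embed W a).
Proof.
rewrite !embedE; apply/matrixP => i j.
by rewrite !mxE agree_off_sym rmorphMn.
Qed.

Lemma embed_trans U V W (sUV : (U `<=` V)%fset) (sVW : (V `<=` W)%fset)
    (a : op U) : embed W (embed V a) = embed W a.
Proof.
have sUW := fsubset_trans sUV sVW.
rewrite (embedE sUV) (embedE sVW) (embedE sUW).
apply/matrixP => i j; rewrite !mxE !enum_rankK.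
rewrite !(conf_restrict_trans sUV sVW sUW) (agree_off_trans sUV sVW).
by case: (agree_off V _ _); case: (agree_off U _ _).
Qed.

End Embeddings.

(** * The isometry extending a configuration by one layer *)

Section Extension.
Variables (K : numClosedFieldType) (L : countType) (d : nat) (d_gt0 : (0 < d)%N).
Variables (adj : rel L) (psi : L -> L -> 'M[K]_d).
Implicit Types U V W : {fset L}.
Notation op := (op K d_gt0).
Notation total := (conf_total d_gt0).

(** The amplitude of the new part of [w] given the old configuration [v]; when [x]
   has a single neighbour in [V], the inner product has one factor. *)
Definition layer_amp V W (v : conf d V) (w : conf d W) : K :=
  \prod_(x : W | val x \notin V) \prod_(y : V | adj (val y) (val x))
     psi (val y) (val x) (v y) (w x).

Definition extension_mx V W (sVW : (V `<=` W)%fset) :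
    'M[K]_(#|conf d W|, #|conf d V|) :=
  \matrix_(i, j) (layer_amp (enum_val j) (enum_val i)
                  *+ (conf_restrict sVW (enum_val i) == enum_val j)).

(** The layer amplitude reads [v] only at neighbours of new sites, and [w] only at
   the new sites. *)
Lemma layer_amp_local U V W (v v' : conf d V) (w w' : conf d W) :
    (U `<=` V)%fset ->
    (forall x y, x \in W -> x \notin V -> y \in U -> ~~ adj y x) ->
    agree_off U v v' -> agree_off U w w' ->
  layer_amp v w = layer_amp v' w'.
Proof.
move=> sUV sepU /agree_offP vv' /agree_offP ww'.
apply: eq_bigr => x xV; apply: eq_bigr => y yx.
rewrite vv' ?ww' //; first by apply: contra xV; apply: (fsubsetP sUV).
by apply/negP => /(sepU _ _ (valP x) xV)/negP.
Qed.

Definition overwrite V W (v : conf d V) (w : conf d W) : conf d W :=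
  [ffun x => if val x \in V then total v (val x) else w x].

Lemma restrict_overwrite V W (sVW : (V `<=` W)%fset) (v : conf d V)
    (w : conf d W) : conf_restrict sVW (overwrite v w) = v.
Proof.
by apply/ffunP => y; rewrite !ffunE /= (valP y) conf_totalE.
Qed.

Lemma agree_off_overwrite V W (v : conf d V) (w : conf d W) :
  agree_off V w (overwrite v w).
Proof. by apply/agree_offP => x /negbTE xV; rewrite ffunE xV. Qed.

Lemma overwrite_unique V W (sVW : (V `<=` W)%fset) (v : conf d V)
    (w w' : conf d W) :
  agree_off V w w' -> conf_restrict sVW w' = v -> w' = overwrite v w.
Proof.
move=> /agree_offP ww' <-; apply/ffunP => x; rewrite ffunE.
case: ifPn => [xV|xV]; last by rewrite ww'.
by rewrite (conf_totalE _ _ [` xV]%fset) ffunE; congr (w' _); apply: val_inj.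
Qed.

(** Both sides have a single surviving intermediate configuration, [overwrite v w]
   on the left and the restriction of [w] on the right, and they vanish unless
   [w] and [v] agree on [V] outside [U].  The layer amplitudes are then equal by
   locality. *)
Lemma extension_mx_commute U V W (sUV : (U `<=` V)%fset)
    (sVW : (V `<=` W)%fset) (c : op U) :
    (forall x y, x \in W -> x \notin V -> y \in U -> ~~ adj y x) ->
  embed W c *m extension_mx sVW = extension_mx sVW *m embed V c.
Proof.
move=> sepU; have sUW := fsubset_trans sUV sVW.
rewrite (embedE sUV) (embedE sUW).
apply/matrixP => i j; rewrite !mxE.
set w := enum_val i; set v := enum_val j.
rewrite (bigD1 (enum_rank (overwrite v w))) //= big1 ?addr0 => [|k kN];
  last first.
  rewrite !mxE -/w -/v; case: eqP => [Ek|_]; last by rewrite mulr0n mulr0.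
  rewrite (agree_off_trans sUV sVW); case: (boolP (agree_off V _ _)) => /= [ak|_].
    case/eqP: kN; rewrite -(overwrite_unique ak Ek).
    by rewrite enum_valK.
  by rewrite mulr0n mul0r.
rewrite (bigD1 (enum_rank (conf_restrict sVW w))) //= big1 ?addr0 => [|k kN];
  last first.
  rewrite !mxE -/w -/v; case: eqP => [Ek|_]; last by rewrite mulr0n mul0r.
  by case/eqP: kN; rewrite Ek enum_valK.
rewrite !mxE !enum_rankK -/w -/v !eqxx restrict_overwrite eqxx !mulr1n.
rewrite (agree_off_trans sUV sVW) agree_off_overwrite restrict_overwrite /=.
case: (boolP (agree_off U _ _)) => [awv|_]; last by rewrite !mulr0n mulr0 mul0r.
rewrite !mulr1n mulrC; congr (_ * _).
  apply: (layer_amp_local sUV sepU); first by rewrite agree_off_sym.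
  by rewrite agree_off_sym (agree_off_trans sUV sVW) agree_off_overwrite
             restrict_overwrite.
by rewrite -!(conf_restrict_trans sUV sVW sUW) restrict_overwrite.
Qed.

End Extension.

Section Isometry.
Variables (K : numClosedFieldType) (L : countType) (d : nat) (d_gt0 : (0 < d)%N).
Variables (adj : rel L) (psi : L -> L -> 'M[K]_d).
Implicit Types U V W : {fset L}.
Notation total := (conf_total d_gt0).

Hypothesis psi_unit : forall x y, adj x y ->
  forall i, \sum_j `|psi x y i j| ^+ 2 = 1.

(** The configurations extending [v] form a product over sites, so the sum of their
   weights is a product of sums over the spin at one site: a single term at an old site, and
   the row of the amplitude matrix of the edge from its parent at a new one. *)
Lemma sum_layer_amp V W (sVW : (V `<=` W)%fset) (v : conf d V) :
    (forall x, x \in W -> x \notin V ->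
       exists2 y, y \in V & forall z, z \in V -> adj z x = (z == y)) ->
  \sum_(w | conf_restrict sVW w == v) `|layer_amp adj psi v w| ^+ 2 = 1.
Proof.
move=> parent.
(* The factor at an old site forces the spin prescribed by [v]. *)
pose G (x : W) (i : 'I_d) : K :=
  if val x \in V then (i == total v (val x))%:R
  else \prod_(y : V | adj (val y) (val x)) `|psi (val y) (val x) (v y) i| ^+ 2.
transitivity (\sum_(w : conf d W) \prod_x G x (w x)).
  rewrite big_mkcond; apply: eq_bigr => w _.
  rewrite (bigID (fun x : W => val x \in V)) /= [X in _ = _ * X](eq_bigr
    (fun x : W => \prod_(y : V | adj (val y) (val x))
       `|psi (val y) (val x) (v y) (w x)| ^+ 2)); last first.
    by move=> x /negbTE xV; rewrite /G xV.
  have -> : \prod_(x : W | val x \notin V) \prod_(y : V | adj (val y) (val x))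
       `|psi (val y) (val x) (v y) (w x)| ^+ 2 = `|layer_amp adj psi v w| ^+ 2.
    rewrite normr_prod -prodrXl; apply: eq_bigr => x _.
    by rewrite normr_prod -prodrXl.
  rewrite (_ : \prod_(x : W | val x \in V) _ = (conf_restrict sVW w == v)%:R).
    by case: eqP; rewrite ?mul1r ?mul0r.
  have [Ev|wv] := eqVneq (conf_restrict sVW w) v.
    rewrite big1 // => x xV; rewrite /G xV (conf_totalE _ _ [` xV]%fset) -Ev ffunE.
    by rewrite (_ : fincl sVW _ = x) ?eqxx //; apply: val_inj.
  have /existsP[y wvy] : [exists y, conf_restrict sVW w y != v y].
    rewrite -negb_forall; apply: contra wv => /forallP wv.
    by apply/eqP/ffunP => y; apply/eqP.
  rewrite (bigD1 (fincl sVW y)) ?(valP y) //= /G (valP y) (conf_totalE _ v y).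
  by rewrite ffunE in wvy; rewrite (negbTE wvy) mul0r.
rewrite -bigA_distr_bigA big1 // => x _.
have [xV|xV] := boolP (val x \in V); rewrite /G ?xV ?(negbTE xV).
  by rewrite (bigD1 (total v (val x))) //= eqxx big1 ?addr0 // => i /negbTE ->.
have [y yV yx] := parent _ (valP x) xV.
rewrite -[RHS](psi_unit (x := y) (y := val x) _ (v [` yV]%fset)) ?yx ?eqxx //.
apply: eq_bigr => i _; rewrite (big_pred1 [` yV]%fset) // => z /=.
by rewrite yx ?(valP z).
Qed.

Lemma extension_mx_isometry V W (sVW : (V `<=` W)%fset) :
    (forall x, x \in W -> x \notin V ->
       exists2 y, y \in V & forall z, z \in V -> adj z x = (z == y)) ->
  (extension_mx adj psi sVW)^t* *m extension_mx adj psi sVW = 1%:M.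
Proof.
move=> parent; apply/matrixP => i j; rewrite !mxE.
under eq_bigr do rewrite !mxE rmorphMn /=.
rewrite (reindex (@enum_rank (conf d W))) /=;
  last exact: onW_bij (enum_rank_bij _).
under eq_bigr do rewrite enum_rankK.
have [->|ij] := eqVneq i j.
  rewrite -[RHS](sum_layer_amp sVW (enum_val j) parent) [RHS]big_mkcond.
  apply: eq_bigr => w _; rewrite normCKC.
  by case: eqP => _; rewrite ?mulr1n // mulr0n mul0r.
rewrite big1 // => w _; case: eqP => [Ei|_]; last by rewrite mulr0n mul0r.
case: eqP => [Ej|_]; last by rewrite mulr0n mulr0.
by case/eqP: ij; apply: enum_val_inj; rewrite -Ei.
Qed.

End Isometry.

(** * Factorization of the vectors [psi_vec] *)

Section Factorization.
Variables (K : numClosedFieldType) (L : countType) (d : nat) (d_gt0 : (0 < d)%N).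
Variables (adj : rel L) (psi : L -> L -> 'M[K]_d).
Implicit Types U V W : {fset L}.
Notation total := (conf_total d_gt0).

Hypothesis adjS : symmetric adj.
Hypothesis psiS : forall x y, adj x y -> forall i j, psi y x j i = psi x y i j.

Definition orientation (T : Type) (e o : rel T) : Prop :=
  forall x y, e x y -> o x y = ~~ o y x.

(** Edges that the two orientations orient differently are matched by the swap of
   their ends. *)
Lemma big_orientation (T : finType) (e o o' : rel T) (F : T -> T -> K) :
    symmetric e -> orientation e o -> orientation e o' ->
    (forall x y, e x y -> F x y = F y x) ->
  \prod_(p : T * T | e p.1 p.2 && o p.1 p.2) F p.1 p.2 =
  \prod_(p : T * T | e p.1 p.2 && o' p.1 p.2) F p.1 p.2.
Proof.
move=> eS oP o'P FS.
rewrite (bigID (fun p : T * T => o' p.1 p.2)).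
rewrite [RHS](bigID (fun p : T * T => o p.1 p.2)) /=.
congr (_ * _); first by apply: eq_bigl => p; rewrite andbAC.
pose sw (p : T * T) := (p.2, p.1).
have swK : involutive sw by case.
rewrite [RHS](reindex_inj (inv_inj swK)) /=.
apply: eq_big => [[x y]|[x y]] /=.
  rewrite (eS y x); case exy: (e x y) => //=.
  by rewrite (oP x y exy) (o'P x y exy) negbK andbC.
by case/andP => /andP[exy _] _; exact: FS.
Qed.

(** A numbering of all of [L] orients the edges of every region at once, unlike the
   enumeration ranks inside [psi_vec], which depend on the region. *)
Lemma orientation_pickle (e : rel L) : irreflexive e ->
  orientation e (fun x y => choice.pickle x < choice.pickle y)%N.
Proof.
move=> eN x y exy; rewrite -leqNgt ltn_neqAle andb_idl // => _.
rewrite (inj_eq (pcan_inj choice.pickleK)).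
by apply: contraTneq exy => ->; rewrite eN.
Qed.

Lemma psi_vecE V (o : rel L) (t : L -> 'I_d) :
    irreflexive adj -> orientation adj o ->
  psi_vec adj psi V (enum_rank (conf_of V t)) 0 =
  \prod_(x <- V) \prod_(y <- V | adj x y && o x y) psi x y (t x) (t y).
Proof.
move=> adjN oP; rewrite mxE /= enum_rankK.
pose e : rel V := fun x y => adj (val x) (val y).
pose o' : rel V := fun x y => o (val x) (val y).
pose rk : rel V := fun x y => (enum_rank x < enum_rank y)%N.
pose F (x y : V) := psi (val x) (val y) (conf_of V t x) (conf_of V t y).
transitivity (\prod_(p : V * V | e p.1 p.2 && o' p.1 p.2) F p.1 p.2).
  apply: (@big_orientation _ e rk o' F).
  - by move=> x y; apply: adjS.
  - move=> x y exy; rewrite /rk -leqNgt ltn_neqAle andb_idl // => _.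
    rewrite (inj_eq val_inj) (inj_eq enum_rank_inj).
    by apply: contraTneq exy => ->; rewrite /e adjN.
  - by move=> x y; apply: oP.
  - by move=> x y exy; apply/esym/psiS.
rewrite big_seq_fsetE /=.
under [RHS]eq_bigr do rewrite big_seq_fsetE /=.
rewrite pair_big_dep /=; apply: eq_bigr => p _.
by rewrite /F !ffunE.
Qed.

Lemma layer_ampE V W (t : L -> 'I_d) :
  layer_amp adj psi (conf_of V t) (conf_of W t) =
  \prod_(x <- W | x \notin V) \prod_(y <- V | adj y x) psi y x (t y) (t x).
Proof.
rewrite big_seq_fsetE /=; apply: eq_bigr => x _.
by rewrite big_seq_fsetE /=; apply: eq_bigr => y _; rewrite !ffunE.
Qed.

Lemma big_fset_sub V W (P : pred L) (F : L -> K) : (V `<=` W)%fset ->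
  \prod_(x <- W | (x \in V) && P x) F x = \prod_(x <- V | P x) F x.
Proof.
move=> sVW; rewrite -big_filter_cond; apply: perm_big.
apply: uniq_perm; rewrite ?filter_uniq // => x.
by rewrite mem_filter andb_idr //; apply: (fsubsetP sVW).
Qed.

(** With the edges between [V] and the new layer oriented outwards, the product
   over the oriented edges of [W] splits into those inside [V] and those leaving
   [V], which make up the layer amplitude. *)
Lemma psi_vec_extension V W (sVW : (V `<=` W)%fset) : irreflexive adj ->
    (forall x y, x \in W -> y \in W -> x \notin V -> y \notin V -> ~~ adj x y) ->
  psi_vec adj psi W = extension_mx adj psi sVW *m psi_vec adj psi V.
Proof.
move=> adjN layer_indep; apply/matrixP => i j.
rewrite [j]ord1 -[in LHS](enum_valK i) [RHS]mxE.
set w := enum_val i; pose t := total w.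
have wE : w = conf_of W t by rewrite conf_totalK.
rewrite (bigD1 (enum_rank (conf_restrict sVW w))) //= big1 ?addr0 => [|k kN];
  last first.
  rewrite [extension_mx _ _ _ _ _]mxE -/w.
  case: eqP => [Ek|_]; last by rewrite mulr0n mul0r.
  by case/eqP: kN; rewrite Ek enum_valK.
rewrite [extension_mx _ _ _ _ _]mxE -/w !enum_rankK eqxx mulr1n.
rewrite wE conf_restrict_of layer_ampE.
pose pk : rel L := fun x y => (choice.pickle x < choice.pickle y)%N.
pose o : rel L := fun x y => if (x \in V) == (y \in V) then pk x y else x \in V.
have pkP : orientation adj pk by apply: orientation_pickle.
have oP : orientation adj o.
  move=> x y axy; rewrite /o [in RHS]eq_sym.
  by case: (x \in V); case: (y \in V) => //=; apply: pkP.
rewrite (psi_vecE V _ adjN pkP) (psi_vecE W _ adjN oP).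
rewrite (bigID (mem V)) /= [X in _ * X]big_seq_cond [X in _ * X]big1; last first.
  move=> x /andP[xW xV]; rewrite big_seq_cond big1 // => y /and3P[yW axy].
  rewrite /o (negbTE xV); case yV: (y \in V) => //= _.
  by move: (layer_indep x y xW yW xV); rewrite yV axy => /(_ isT).
rewrite mulr1 -(eq_bigl _ _ (fun x => andbT (x \in V))) (big_fset_sub _ _ sVW).
transitivity (\prod_(x <- V)
    ((\prod_(y <- W | (y \notin V) && adj x y) psi x y (t x) (t y)) *
     \prod_(y <- V | adj x y && pk x y) psi x y (t x) (t y))).
  rewrite big_seq [RHS]big_seq; apply: eq_bigr => x xV.
  rewrite (bigID (fun y => y \notin V)) /=; congr (_ * _).
    apply: eq_bigl => y; rewrite /o xV; case: (y \in V) => //=.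
      by rewrite andbF.
    by rewrite !andbT.
  rewrite -(big_fset_sub _ _ sVW); apply: eq_bigl => y; rewrite /o xV.
  by case: (y \in V) => //=; rewrite ?andbF ?andbT.
rewrite big_split /=; congr (_ * _).
rewrite (exchange_big_dep (fun y => y \notin V)) //=.
  by apply: eq_bigr => x ->.
by move=> x y _ /andP[].
Qed.

End Factorization.

(** * Balls in a tree *)

Section Trees.
Variables (L : countType) (adj : rel L).
Hypothesis adjS : symmetric adj.

Lemma connected_fset1 (x : L) : connected_fset adj [fset x]%fset.
Proof. by move=> y z; rewrite !inE => /eqP -> /eqP ->; exists [::]. Qed.

(** A path [x :: q] outside the connected set [V], both of whose ends have a
   neighbour in [V], closes up to a cycle with a simple path inside [V]; in an
   acyclic graph that cycle must be an edge traversed twice.  The case [q = [::]]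
   gives the uniqueness of the parent, and [q] of length one shows that no edge
   joins two sites of a layer. *)
Lemma excursion_trivial (V : {fset L}) (x y z : L) (q : seq L) :
    acyclic adj -> connected_fset adj V -> y \in V -> z \in V ->
    path adj x q -> uniq (x :: q) -> {in x :: q, forall t, t \notin V} ->
    adj (last x q) y -> adj z x ->
  q = [::] /\ y = z.
Proof.
move=> acyc conV yV zV xq Uq qV qy zx.
have [p [yp pV pz]] := conV y z yV zV.
move: pz; case/shortenP: yp => p' yp' Up' sp' p'z.
have p'V t : t \in y :: p' -> t \in V.
  by rewrite inE => /orP[/eqP -> //|/sp' /(allP pV)].
have /acyc : ucycle adj (x :: q ++ y :: p').
  apply/andP; split.
    by rewrite /= rcons_cat cat_path xq /= qy rcons_path yp' p'z zx.
  rewrite -cat_cons cat_uniq Uq Up' andbT; apply/hasPn => t tp.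
  by apply/negP => /qV; rewrite p'V.
rewrite /= size_cat /= addnS !ltnS.
by case: q {xq Uq qV qy} => [|//]; case: p' {yp' Up' sp' p'V} p'z.
Qed.

Lemma in_out_boundary (V : {fset L}) x : locally_finite adj ->
  (x \in out_boundary adj V) = (x \notin V) && [exists y : V, adj x (val y)].
Proof.
move=> lf; rewrite in_fset_set.
  apply/idP/idP => [|/andP[xV /existsP[y xy]]].
    rewrite inE => -[xV [y yV xy]]; rewrite xV.
    by apply/existsP; exists [` yV]%fset.
  by rewrite inE; split => //; exists (val y) => //; apply: valP.
apply: (@sub_finite_set _ _ (\bigcup_(y in [set` V]) [set x | adj y x])).
  by move=> t [tV [y yV ty]]; exists y => //=; rewrite adjS.
by apply: bigcup_finite => // y _; apply: lf.
Qed.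

Lemma in_bar (V : {fset L}) x : locally_finite adj ->
  (x \in bar adj V) = (x \in V) || [exists y : V, adj x (val y)].
Proof.
move=> lf; rewrite in_fsetU in_out_boundary //.
by case: (x \in V).
Qed.

Lemma bar_sub (V : {fset L}) : (V `<=` bar adj V)%fset.
Proof. exact: fsubsetUl. Qed.

Lemma connected_bar (V : {fset L}) : locally_finite adj ->
  connected_fset adj V -> connected_fset adj (bar adj V).
Proof.
move=> lf conV x y xB yB.
have inV t : t \in V -> t \in bar adj V by apply: (fsubsetP (bar_sub V)).
have enter t : t \in bar adj V -> exists2 s, s \in V & s = t \/ adj t s.
  rewrite in_bar // => /orP[tV|/existsP[s ts]]; first by exists t => //; left.
  by exists (val s); [apply: valP|right].
have [x0 x0V xx0] := enter x xB; have [y0 y0V yy0] := enter y yB.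
have [p [x0p pV py0]] := conV _ _ x0V y0V.
have pB : all (mem (bar adj V)) p by apply/allP => t /(allP pV)/inV.
have [q [x0q qB qy]] :
    exists q, [/\ path adj x0 q, all (mem (bar adj V)) q & last x0 q = y].
  case: yy0 => [<-|yy0]; first by exists p.
  exists (rcons p y); rewrite rcons_path last_rcons all_rcons x0p py0 adjS yy0.
  by rewrite /= yB pB.
case: xx0 => [<-|xx0]; first by exists q.
by exists (x0 :: q); rewrite /= xx0 x0q qB inV.
Qed.

Variable x1 : L.
Notation B := (ball_seq adj x1).

Lemma ball_subS n : (B n `<=` B n.+1)%fset.
Proof. by case: n => [|n]; [apply: fsub0set|apply: bar_sub]. Qed.

Lemma ball_sub m n : (m <= n)%N -> (B m `<=` B n)%fset.
Proof.
move/subnK <-; elim: (n - m)%N => // k IH.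
exact: fsubset_trans IH (ball_subS _).
Qed.

Lemma connected_ball n : locally_finite adj -> connected_fset adj (B n.+1).
Proof.
move=> lf; elim: n => [|n IH]; first exact: connected_fset1.
exact: connected_bar.
Qed.

Lemma ball_absorbs x y n : locally_finite adj ->
  x \in B n -> adj x y -> y \in B n.+1.
Proof.
case: n => [//|n] lf xB xy; rewrite [B _]/(bar adj (B n.+1)) in_bar //.
by apply/orP; right; apply/existsP; exists [` xB]%fset; rewrite adjS.
Qed.

Lemma ball_exhausting : locally_finite adj -> connected_graph adj ->
  exhausting adj B.
Proof.
move=> lf conn; split=> // [|x]; first exact: ball_subS.
have [p + <-] := conn x1 x.
elim/last_ind: p => [|p y IH]; first by exists 1%N; rewrite /= !inE.
rewrite rcons_path last_rcons => /andP[/IH[n pn] py].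
by exists n.+1; apply: ball_absorbs pn py.
Qed.

(** Along the balls, limits over finite connected sets become limits of
   sequences. *)
Lemma ball_cofinal : locally_finite adj -> connected_graph adj ->
  B n.+1 @[n --> \oo] --> connected_increasing adj.
Proof.
move=> lf conn S [V0 conV0 sV0].
have [_ _ _ exh] := ball_exhausting lf conn.
pose f (x : V0) := projT1 (cid (exh (val x))).
exists (\max_x f x)%N => // n /= fn; apply: sV0.
split; first exact: connected_ball.
apply/fsubsetP => x xV0.
have le : (f [` xV0]%fset <= n.+1)%N.
  by apply: leqW; apply: leq_trans fn; apply: (leq_bigmax [` xV0]%fset).
exact: (fsubsetP (ball_sub le) _ (projT2 (cid (exh (val [` xV0]%fset))))).
Qed.

End Trees.

(** * The Markov chain *)

Section Compression.
Variables (K : numClosedFieldType) (L : countType) (d : nat) (d_gt0 : (0 < d)%N).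
Variables (adj : rel L) (psi : L -> L -> 'M[K]_d).
Implicit Types U V W : {fset L}.
Notation op := (op K d_gt0).

(** As psi_W = T psi_V for the extension map T, the expectation of [a] in psi_W is
   that of its compression in psi_V. *)
Definition compression V W (sVW : (V `<=` W)%fset) (a : op W) : op V :=
  (extension_mx adj psi sVW)^t* *m a *m extension_mx adj psi sVW.

Lemma compression_quasi_conditional U V W (sUV : (U `<=` V)%fset)
    (sVW : (V `<=` W)%fset) :
    (forall x y, adj x y -> forall i, \sum_j `|psi x y i j| ^+ 2 = 1) ->
    (forall x, x \in W -> x \notin V ->
       exists2 y, y \in V & forall z, z \in V -> adj z x = (z == y)) ->
    (forall x y, x \in W -> x \notin V -> y \in U -> ~~ adj y x) ->
  quasi_conditional_expectation (embed (d_gt0 := d_gt0) (V := U) V) (embed W)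
    (compression sVW).
Proof.
move=> psi1 parent sepU; split.
- move=> k a b; rewrite /compression mulmxDr mulmxDl.
  by rewrite -scalemxAr -scalemxAl.
- rewrite /compression; have -> : (1 : op W) = 1%:M by [].
  by rewrite mulmx1; apply: extension_mx_isometry parent.
- exact: compression_completely_positive.
(* The intertwining relation for [star c], read through the adjoint, moves [c]
   to the left of T^*. *)
move=> c a; rewrite (embed_trans sUV sVW) /compression !op_mulE.
rewrite -[c in LHS]starK (embed_star (fsubset_trans sUV sVW)) op_starE.
rewrite mulmxA -mxadjM (extension_mx_commute psi sUV sVW _ sepU) mxadjM.
by rewrite -op_starE -(embed_star sUV) starK -!mulmxA.
Qed.

Lemma expect_compression V W (sVW : (V `<=` W)%fset) (a : op W) :
    symmetric adj -> irreflexive adj ->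
    (forall x y, adj x y -> forall i j, psi y x j i = psi x y i j) ->
    (forall x y, x \in W -> y \in W -> x \notin V -> y \notin V -> ~~ adj x y) ->
  expect adj psi (compression sVW a) = expect adj psi a.
Proof.
move=> adjS adjN psiS indep.
rewrite /expect (psi_vec_extension d_gt0 adjS psiS sVW adjN indep) /inner mxadjM.
by rewrite /compression !mulmxA.
Qed.

Lemma psi_vec1 (x : L) : psi_vec adj psi [fset x]%fset = const_mx 1.
Proof.
apply/matrixP => i j; rewrite !mxE /= big_pred0 // => -[y z] /=.
have -> : y = z.
  by apply: val_inj; move: (valP y) (valP z); rewrite !inE => /eqP -> /eqP ->.
by rewrite ltnn andbF.
Qed.

(** The vector of a single site is the sum of all basis vectors, whose squared norm
   is [d]; this is where the factor 1/d comes from. *)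
Lemma initial_state (x : L) :
  is_state (fun a : op [fset x]%fset => d%:R^-1 * expect adj psi a).
Proof.
have d0 : d%:R != 0 :> K by rewrite pnatr_eq0 -lt0n.
split.
- move=> k a b; rewrite /expect /inner mulmxDl -scalemxAl mulmxDr -scalemxAr !mxE.
  by rewrite mulrDr mulrCA.
- rewrite /expect /inner psi_vec1; have -> : (1 : op [fset x]%fset) = 1%:M by [].
  rewrite mul1mx !mxE (eq_bigr (fun=> 1)).
    by rewrite sumr_const !card_ord card_ffun card_ord -cardfE cardfs1 expn1 mulVf.
  by move=> i _; rewrite !mxE rmorph1 mulr1.
move=> a; rewrite mulr_ge0 ?invr_ge0 ?ler0n // /expect /inner op_starE op_mulE.
by rewrite -mulmxA mulmxA -mxadjM gram_diag_ge0.
Qed.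

End Compression.

Theorem proposition5p6 (R : realType) (L : countType) (adj : rel L) (d : nat)
    (d_gt0 : (0 < d)%N)
    (psi : L -> L -> 'M[R[i]]_d)
    (BL : cstarAlgType R[i]) (iota : forall V : {fset L}, op R[i] d_gt0 V -> BL)
    (phi : BL -> R[i]) (x1 : L) :
  is_tree adj ->
  amplitudes adj psi ->
  inductive_limit iota ->
  is_state phi ->
  (forall (V : {fset L}) (a : op R[i] d_gt0 V),
     let u := fun W : {fset L} => expect (d_gt0 := d_gt0) adj psi (embed W a) in
     cvg (u @ connected_increasing adj) /\
     phi (iota V a) = d%:R^-1 * lim (u @ connected_increasing adj)) ->
  d_markov_chain adj iota (ball_seq adj x1) phi.
Proof.
move=> [[adjS adjN] lf conn acyc] amp _ phi_state phi_lim.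
have psi1 x y : adj x y -> forall i, \sum_j `|psi x y i j| ^+ 2 = 1 by case/amp.
have psiS x y : adj x y -> forall i j, psi y x j i = psi x y i j by case/amp.
pose B := ball_seq adj x1.
have conB n : connected_fset adj (B n.+1) by apply: connected_ball.
have parent n x : x \in B n.+2 -> x \notin B n.+1 ->
    exists2 y, y \in B n.+1 & forall z, z \in B n.+1 -> adj z x = (z == y).
  rewrite [B n.+2]/(bar adj (B n.+1)) in_bar // => /orP[->//|/existsP[y xy]] xB.
  exists (val y) => [|z zB]; first exact: valP.
  apply/idP/eqP => [zx|->]; last by rewrite adjS.
  have xout : {in [:: x], forall t, t \notin B n.+1}.
    by move=> t; rewrite inE => /eqP ->.
  by have [] := excursion_trivial acyc (conB n) (valP y) zB
                  (q := [::]) (x := x) isT isT xout xy zx.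
have indep n x y : x \in B n.+2 -> y \in B n.+2 -> x \notin B n.+1 ->
    y \notin B n.+1 -> ~~ adj x y.
  move=> xB yB xN yN; apply/negP => xy.
  have [x' x'B xx'] := parent n x xB xN; have [y' y'B yy'] := parent n y yB yN.
  have out : {in [:: x; y], forall t, t \notin B n.+1}.
    by move=> t; rewrite !inE => /orP[] /eqP ->.
  have [] // := excursion_trivial acyc (conB n) y'B x'B
                  (q := [:: y]) (x := x) _ _ out _ _.
  - by rewrite /= xy.
  - by rewrite /= inE andbT; apply: contraTneq xy => ->; rewrite adjN.
  - by rewrite /= adjS yy'.
  - by rewrite xx'.
(* For [n = 0] the innermost region is empty. *)
have sep n x y : x \in B n.+2 -> x \notin B n.+1 -> y \in B n -> ~~ adj y x.
  by move=> _ xN yB; apply: contra xN; apply: ball_absorbs.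
split; [exact: ball_exhausting | by [] |].
pose rho (a : op R[i] d_gt0 (B 1%N)) := d%:R^-1 * expect adj psi a.
pose E n := @compression R[i] L d d_gt0 adj psi _ _ (ball_subS adj x1 n.+1).
exists rho, E; split => [|n|V a].
- exact: initial_state.
- apply: compression_quasi_conditional => //.
  + exact: ball_subS.
  + exact: parent.
  + exact: sep.
have compE n (b : op R[i] d_gt0 (B n.+1)) :
    markov_comp rho E b = d%:R^-1 * expect adj psi b.
  elim: n b => [|n IH] b //=.
  by rewrite IH /E expect_compression //; apply: indep.
under eq_fun do rewrite compE.
have [cvgu ->] := phi_lim V a.
apply: cvgMl_tmp.
exact: cvg_comp (@ball_cofinal _ _ adjS x1 lf conn) cvgu.
Qed.
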